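(* Let $N\ge1$, $\sigma_0>0$, $p_A\in(0,1)$, $a\ge0$. If $0<\sigma_1<\sigma_0$ and $\xi_>(a,\sigma_1)\le\tfrac12$, then $a\le\sigma_0\Phi^{-1}(p_A)$. If $\sigma_1>\sigma_0$ and $\xi_<(a,\sigma_1)\le\tfrac12$, then $a\le\sigma_0\Phi^{-1}(p_A)$. (Here $\sigma_0\Phi^{-1}(p_A)$ is the constant-$\sigma_0$ certified radius $\frac{\sigma_0}{2}(\Phi^{-1}(p_A)-\Phi^{-1}(1-p_A))$ of Cohen et al.)
   Context: $\Phi^{-1}$ is the quantile function of the standard normal distribution. $\chi^2_N(\lambda,x)=\mathbb{P}(\|Z+\mu\|^2\le x)$ for $Z\sim\mathcal{N}(0,I_N)$, $\|\mu\|^2=\lambda\ge 0$ (noncentral chi-squared cdf), and $\chi^2_{N,qf}(\lambda,p)=\inf\{x:\chi^2_N(\lambda,x)\ge p\}$ for $p\in(0,1)$. Fix $N$, $\sigma_0>0$, $p_A\in(0,1)$. For $a\ge0$ and $0<\sigma_1<\sigma_0$ define $$\xi_>(a,\sigma_1)=\chi^2_N\!\left(\frac{\sigma_1^2a^2}{(\sigma_0^2-\sigma_1^2)^2},\ \frac{\sigma_0^2}{\sigma_1^2}\chi^2_{N,qf}\!\left(\frac{\sigma_0^2a^2}{(\sigma_0^2-\sigma_1^2)^2},1-p_A\right)\right),$$ and for $\sigma_1>\sigma_0$ define $$\xi_<(a,\sigma_1)=1-\chi^2_N\!\left(\frac{\sigma_1^2a^2}{(\sigma_1^2-\sigma_0^2)^2},\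 \frac{\sigma_0^2}{\sigma_1^2}\chi^2_{N,qf}\!\left(\frac{\sigma_0^2a^2}{(\sigma_1^2-\sigma_0^2)^2},p_A\right)\right).$$ These equal the maximal probability $\mathbb{P}(f(Y_1)=B)$, $Y_1\sim\mathcal N(x_1,\sigma_1^2 I_N)$, over binary classifiers $f$ with $\mathbb{P}(f(Y_0)=B)\le 1-p_A$, $Y_0\sim\mathcal N(x_0,\sigma_0^2I_N)$, where $a=\|x_1-x_0\|$. *)

(* Defs.v *)
From HB Require Import structures.
From mathcomp Require Import all_boot all_order all_algebra.
From mathcomp Require Import all_classical all_reals all_analysis.
From mathcomp Require Import normal_distribution.
Set Implicit Arguments. Unset Strict Implicit. Unset Printing Implicit Defensive.
Import Order.TTheory GRing.Theory Num.Theory.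
Local Open Scope classical_set_scope.
Local Open Scope ring_scope.

Section Defs.
Variable R : realType.

Definition quantile (F : R -> R) (p : R) : R := inf [set x | p <= F x].

Definition Phi (x : R) : R := fine (normal_prob 0 1 `]-oo, x]).
Definition Phi_inv (p : R) : R := quantile Phi p.

(* gauss_int n f = E[f(Z_1,...,Z_n)] for Z_1,...,Z_n i.i.d. N(0,1),
   computed as an iterated Lebesgue integral against the N(0,1) density *)
Fixpoint gauss_int (n : nat) (f : seq R -> \bar R) : \bar R :=
  match n with
  | 0 => f [::]
  | n'.+1 => (\int[lebesgue_measure]_t
               ((normal_pdf 0 1 t)%:E * gauss_int n' (fun s => f (t :: s))))%E
  end.

(* squared norm of z + mu, where mu = (sqrt lam, 0, ..., 0), so ||mu||^2 = lam *)
Definition shifted_sqnorm (lam : R) (s : seq R) : R :=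
  \sum_(i < size s) (s`_i + (nat_of_ord i == 0%N)%:R * Num.sqrt lam) ^+ 2.

Definition chi2_cdf (N : nat) (lam x : R) : R :=
  fine (gauss_int N (fun s => (if shifted_sqnorm lam s <= x then 1 else 0)%:E)).

Definition chi2_qf (N : nat) (lam p : R) : R := quantile (chi2_cdf N lam) p.

Definition xi_gt (N : nat) (sigma0 pA a sigma1 : R) : R :=
  chi2_cdf N (sigma1 ^+ 2 * a ^+ 2 / (sigma0 ^+ 2 - sigma1 ^+ 2) ^+ 2)
    (sigma0 ^+ 2 / sigma1 ^+ 2 *
      chi2_qf N (sigma0 ^+ 2 * a ^+ 2 / (sigma0 ^+ 2 - sigma1 ^+ 2) ^+ 2) (1 - pA)).

Definition xi_lt (N : nat) (sigma0 pA a sigma1 : R) : R :=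
  1 - chi2_cdf N (sigma1 ^+ 2 * a ^+ 2 / (sigma1 ^+ 2 - sigma0 ^+ 2) ^+ 2)
    (sigma0 ^+ 2 / sigma1 ^+ 2 *
      chi2_qf N (sigma0 ^+ 2 * a ^+ 2 / (sigma1 ^+ 2 - sigma0 ^+ 2) ^+ 2) pA).

End Defs.

(* Main.v *)
(** Put the origin at the centre of the optimal ball: with
    theta = a / |sigma0^2 - sigma1^2|, the vector Y_i is N(sigma_i^2 theta e_1,
    sigma_i^2 I), so the likelihood ratio of Y_1 and Y_0 depends on |y|^2 only and,
    by Neyman-Pearson, the centred ball (or its complement) is the most powerful
    region.  Compare it with the half-space bounded by the hyperplane through the
    mean of Y_1 orthogonal to e_1, which Y_1 hits with probability 1/2 and Y_0 with
    probability Phi(-a / sigma0): if a > sigma0 Phi^-1(pA) this is less than 1 - pA,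
    so the optimal region has probability more than 1/2 under Y_1.

    Only the first coordinate is shifted, and the others enter through the sum of
    their squares, so all N-dimensional integrals are iterates of the operator
    M |-> (v |-> int w(t) M(v + t^2) dt) on nonnegative nonincreasing functions of
    the squared norm; monotonicity gives measurability for free. *)
Require Import Defs.
From HB Require Import structures.
From mathcomp Require Import all_boot all_order all_algebra.
From mathcomp Require Import all_classical all_reals all_analysis.
From mathcomp Require Import measurable_realfun normal_distribution.
From mathcomp Require Import ring lra.
Set Implicit Arguments. Unset Strict Implicit. Unset Printing Implicit Defensive.
Import Order.TTheory GRing.Theory Num.Theory.
Import numFieldNormedType.Exports.
Local Open Scope ring_scope.

(** * Affine changes of variable in Lebesgue integrals on the line *)

Section AffineSubstitution.
Variable R : realType.
Local Notation mu := (@lebesgue_measure R).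

(** The image of Lebesgue measure under [t |-> s * t + b], multiplied by [s], gives each interval
    []x, y]] its length, so by uniqueness it is Lebesgue measure itself. *)
Lemma ge0_integral_affine (s b : R) (f : R -> \bar R) : 0 < s ->
  measurable_fun setT f -> (forall y, (0 <= f y)%E) ->
  (\int[mu]_y f y = s%:E * \int[mu]_t f (s * t + b)%R)%E.
Proof.
move=> s0 mf f0.
pose phi : measurableTypeR R -> measurableTypeR R := fun t : R => (s * t + b)%R.
have mphi : measurable_fun setT phi.
  by apply: measurable_funD => //; exact: mulrl_measurable.
pose m_ : {measure set (measurableTypeR R) -> \bar R} :=
  mscale (NngNum (ltW s0)) (pushforward mu phi).
pose m := m_ mphi.
rewrite (@eq_measure_integral _ _ _ setT m); last first.
  move=> A mA _; apply: lebesgue_measure_unique => //= _ [[x y]] _ <-.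
  rewrite /m /m_ /= /mscale/= /pushforward.
  have -> : (phi @^-1` `]x, y]%classic)%classic
      = `](x - b) / s, (y - b) / s]%classic.
    apply/seteqP; split => t /=; rewrite /phi !in_itv/= => /andP[h1 h2];
    move: h1 h2; rewrite ltr_pdivrMr// ler_pdivlMr//; rewrite !(mulrC t) => h1 h2;
    apply/andP; split; lra.
  rewrite !lebesgue_measure_itv/= !lte_fin ltr_pM2r ?invr_gt0// ltrD2r.
  case: ifP => _; last by rewrite mule0.
  by rewrite -!EFinD -EFinM; congr EFin; field; lra.
rewrite ge0_integral_mscale//; congr (_ * _)%E.
by rewrite (ge0_integral_pushforward mphi).
Qed.

Lemma ge0_integral_opp (f : R -> \bar R) :
  measurable_fun setT f -> (forall y, (0 <= f y)%E) ->
  (\int[mu]_y f y = \int[mu]_t f (- t)%R)%E.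
Proof.
move=> mf f0.
transitivity (\int[pushforward mu (-%R : _ -> measurableTypeR R)]_y f y)%E.
  by apply: eq_measure_integral => A mA _; apply/esym/lebesgue_measureN.
by rewrite ge0_integral_pushforward.
Qed.

End AffineSubstitution.

(** * Integrating out one coordinate of a function of the squared norm *)

Section Antitone.
Variable R : realType.
Local Notation mu := (@lebesgue_measure R).
Implicit Types (M : R -> \bar R) (w : R -> R).

Definition ge0_antitone M :=
  (forall v, (0 <= M v)%E) /\ (forall u v, u <= v -> (M v <= M u)%E).

(** The preimage of a ray []a, +oo]] is closed to the left, hence an interval. *)
Lemma ge0_antitone_measurable M : ge0_antitone M -> measurable_fun setT M.
Proof.
move=> [_ aM]; apply: (measurability _ (ErealGenOInfty.measurableE R)).
move=> /= _ [_ [a ->]] <-; apply: measurableI => //.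
apply: is_interval_measurable => s t/=.
rewrite !in_itv/= !andbT => fs ft u /andP[su ut].
by rewrite in_itv/= andbT (lt_le_trans ft)// aM.
Qed.

Lemma ge0_antitone_cst (x : R) : 0 <= x -> ge0_antitone (fun=> x%:E).
Proof. by split => // v; rewrite lee_fin. Qed.

Lemma ge0_antitoneM M M' : ge0_antitone M -> ge0_antitone M' ->
  ge0_antitone (fun v => M v * M' v)%E.
Proof.
move=> [M0 aM] [M'0 aM']; split=> [v|u v uv]; first exact: mule_ge0.
by apply: lee_pmul => //; [exact: aM|exact: aM'].
Qed.

Lemma ge0_antitoneD M M' : ge0_antitone M -> ge0_antitone M' ->
  ge0_antitone (fun v => M v + M' v)%E.
Proof.
move=> [M0 aM] [M'0 aM']; split=> [v|u v uv]; first exact: adde_ge0.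
by apply: leeD => //; [exact: aM|exact: aM'].
Qed.

Lemma ge0_antitone_scale M (s : R) : 0 <= s -> ge0_antitone M ->
  ge0_antitone (fun v => M (s * v)).
Proof. by move=> s0 [M0 aM]; split=> // u v uv; apply: aM; rewrite ler_wpM2l. Qed.

Lemma measurable_sq_shift M (v : R) : ge0_antitone M ->
  measurable_fun setT (fun t : R => M (v + t ^+ 2)%R).
Proof.
move=> aM; apply: measurableT_comp; first exact: ge0_antitone_measurable.
by apply: measurable_funD => //; exact: measurable_funX.
Qed.

(** Here [v] is the squared norm of the coordinates already fixed, and [t] is the coordinate being
    integrated out. *)
Definition sqint w M v := (\int[mu]_t ((w t)%:E * M (v + t ^+ 2)%R))%E.

(** Two weights occur: the standard normal density, and the constant 1, for which [sqint] is plain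
    Lebesgue integration. *)
Definition weight w := measurable_fun setT w /\ forall t, 0 <= w t.

Lemma measurable_sqint w M v : weight w -> ge0_antitone M ->
  measurable_fun setT (fun t => (w t)%:E * M (v + t ^+ 2)%R)%E.
Proof.
move=> [mw w0] aM; apply: emeasurable_funM.
  exact/measurable_EFinP.
exact: measurable_sq_shift.
Qed.

Lemma ge0_sqint w M v t : weight w -> ge0_antitone M ->
  (0 <= (w t)%:E * M (v + t ^+ 2)%R)%E.
Proof. by move=> [_ w0] [M0 _]; rewrite mule_ge0 ?lee_fin. Qed.

Lemma sqint_le w M M' v : weight w -> ge0_antitone M -> ge0_antitone M' ->
  (forall u, (M u <= M' u)%E) -> (sqint w M v <= sqint w M' v)%E.
Proof.
move=> ww aM aM' MM'; apply: ge0_le_integral => //.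
- by move=> t _; exact: ge0_sqint.
- exact: measurable_sqint.
- exact: measurable_sqint.
- by move=> t _; apply: lee_wpmul2l => //; rewrite lee_fin; apply ww.
Qed.

Lemma sqint_antitone w M : weight w -> ge0_antitone M -> ge0_antitone (sqint w M).
Proof.
move=> ww aM; split=> [v|u v uv].
  by apply: integral_ge0 => t _; exact: ge0_sqint.
apply: ge0_le_integral => //.
- by move=> t _; exact: ge0_sqint.
- exact: measurable_sqint.
- exact: measurable_sqint.
- move=> t _; apply: lee_wpmul2l; first by rewrite lee_fin; apply ww.
  by apply aM; rewrite lerD2r.
Qed.

Lemma iter_sqint_antitone k w M : weight w -> ge0_antitone M ->
  ge0_antitone (iter k (sqint w) M).
Proof. by move=> ww aM; elim: k => //= k; exact: sqint_antitone. Qed.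

Lemma iter_sqint_le k w M M' : weight w -> ge0_antitone M -> ge0_antitone M' ->
  (forall u, (M u <= M' u)%E) ->
  forall v, (iter k (sqint w) M v <= iter k (sqint w) M' v)%E.
Proof.
move=> ww aM aM' MM'; elim: k => //= k IH v.
by apply: sqint_le => //; exact: iter_sqint_antitone.
Qed.

Lemma iter_sqintD k w M M' v : weight w -> ge0_antitone M -> ge0_antitone M' ->
  (iter k (sqint w) (fun u => M u + M' u) v =
   iter k (sqint w) M v + iter k (sqint w) M' v)%E.
Proof.
move=> ww aM aM'; elim: k v => //= k IH v.
rewrite (_ : iter k _ (fun u => M u + M' u)%E =
  fun u => iter k (sqint w) M u + iter k (sqint w) M' u)%E; last exact/funext.
have a1 : ge0_antitone (iter k (sqint w) M) by exact: iter_sqint_antitone.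
have a2 : ge0_antitone (iter k (sqint w) M') by exact: iter_sqint_antitone.
rewrite /sqint -ge0_integralD//; last first.
- exact: measurable_sqint.
- by move=> t _; exact: ge0_sqint.
- exact: measurable_sqint.
- by move=> t _; exact: ge0_sqint.
by apply: eq_integral => t _; rewrite ge0_muleDr//; [apply a1|apply a2].
Qed.

Lemma sqintZ w M (x v : R) : weight w -> ge0_antitone M -> 0 <= x ->
  (sqint w (fun u => x%:E * M u) v = x%:E * sqint w M v)%E.
Proof.
move=> ww aM x0; rewrite /sqint -ge0_integralZl_EFin//; last first.
- exact: measurable_sqint.
- by move=> t _; exact: ge0_sqint.
by apply: eq_integral => t _; rewrite muleCA.
Qed.

Lemma iter_sqintZ k w M (x v : R) : weight w -> ge0_antitone M -> 0 <= x ->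
  (iter k (sqint w) (fun u => x%:E * M u) v = x%:E * iter k (sqint w) M v)%E.
Proof.
move=> ww aM x0; elim: k v => //= k IH v.
by rewrite -sqintZ//; [congr sqint; exact/funext|exact: iter_sqint_antitone].
Qed.

End Antitone.

(** * Gaussian integrals of radial functions and their conversion to Lebesgue integrals *)

Section Gauss.
Variable R : realType.
Local Notation mu := (@lebesgue_measure R).
Local Notation phi := (@normal_pdf R 0 1).
Local Notation peak := (@normal_peak R 1).
Local Notation lint := (sqint (fun=> 1%R)).
Implicit Types (v : R) (M : R -> \bar R).

Lemma weight_normal : weight phi.
Proof. by split; [exact: measurable_normal_pdf|exact: normal_pdf_ge0]. Qed.

Lemma weight_cst1 : weight (fun=> 1 : R).
Proof. by split. Qed.

Lemma normal_pdf01E (t : R) : phi t = peak * expR (- t ^+ 2 / 2).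
Proof.
rewrite normal_pdfE ?oner_neq0// /normal_fun subr0 expr1n.
by rewrite -mulr_natr mul1r.
Qed.

Lemma normal_pdfN (t : R) : phi (- t) = phi t.
Proof. by rewrite !normal_pdf01E sqrrN. Qed.

Lemma peak_gt0 : 0 < peak.
Proof. by rewrite normal_peak_gt0// oner_neq0. Qed.

(** The offset [v] is general because the recursion adds to it the square of each coordinate it
    consumes. *)
Lemma gauss_int_radial k M v :
  gauss_int k (fun s => M (v + \sum_(i < size s) s`_i ^+ 2)) =
  iter k (sqint phi) M v.
Proof.
elim: k v => [|k IH] v /=; first by rewrite big_ord0 addr0.
rewrite /sqint; apply: eq_integral => t _; congr (_ * _)%E.
rewrite -IH; congr gauss_int; apply/funext => s.
by rewrite big_ord_recl/= addrA.
Qed.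

Definition below (x v : R) : \bar R := (if v <= x then 1 else 0)%:E.

Lemma below_antitone x : ge0_antitone (below x).
Proof.
split=> [v|u v uv]; rewrite /below; first by case: ifP.
have [vx|_] := leP v x; first by rewrite (le_trans uv vx).
by case: ifP => _; rewrite lee_fin.
Qed.

Lemma below_le1 x v : (below x v <= 1)%E.
Proof. by rewrite /below; case: ifP => _; rewrite lee_fin. Qed.

Lemma iter_normal1 k v : iter k (sqint phi) (fun=> 1%E) v = 1%E.
Proof.
elim: k v => //= k IH v; rewrite -[RHS](integral_normal_pdf 0 1).
by apply: eq_integral => t _; rewrite IH mule1.
Qed.

Lemma iter_normal_le1 k x v : (iter k (sqint phi) (below x) v <= 1)%E.
Proof.
rewrite -[leRHS](iter_normal1 k v); apply: iter_sqint_le.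
- exact: weight_normal.
- exact: below_antitone.
- exact: ge0_antitone_cst.
- exact: below_le1.
Qed.

(** Writing the noncentrality as [m ^+ 2] with [m] nonnegative makes the shift of the first
    coordinate equal to [m]; the other [k] coordinates are radial. *)
Lemma chi2_cdfE k (m x : R) : 0 <= m ->
  chi2_cdf k.+1 (m ^+ 2) x =
  fine (\int[mu]_t ((phi t)%:E *
          iter k (sqint phi) (below x) ((t + m) ^+ 2)%R))%E.
Proof.
move=> m0; congr fine => /=; apply: eq_integral => t _; congr (_ * _)%E.
rewrite -gauss_int_radial; congr gauss_int; apply/funext => s.
rewrite /below /shifted_sqnorm/= big_ord_recl/= mul1r sqrtr_sqr ger0_norm//.
congr ((if _ + _ <= _ then _ else _)%:E).
by apply: eq_bigr => i _; rewrite mul0r addr0.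
Qed.

(** The density of N(0, s^2 I) without its normalising constant, as a function of the squared norm
    [u]. *)
Definition gw (s u : R) : R := expR (- u / (s ^+ 2 *+ 2)).

Lemma gw_antitone (s : R) : 0 < s -> ge0_antitone (fun u => (gw s u)%:E).
Proof.
move=> s0; split=> [v|u v uv]; rewrite lee_fin ?expR_ge0// ler_expR.
by rewrite ler_wpM2r ?lerN2// invr_ge0 mulrn_wge0// sqr_ge0.
Qed.

Definition tilt (s : R) M (u : R) : \bar R := ((gw s u)%:E * M u)%E.

Lemma tilt_antitone (s : R) M : 0 < s -> ge0_antitone M -> ge0_antitone (tilt s M).
Proof. by move=> s0 aM; apply: ge0_antitoneM => //; exact: gw_antitone. Qed.

(* Substituting [t = y / s] turns the Gaussian weight into a factor that depends
   on [v + t ^+ 2] only, so it moves into the integrand. *)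
Lemma sqint_tilt (s : R) M v : 0 < s -> ge0_antitone M ->
  sqint phi (fun u => M (s ^+ 2 * u)) v =
  ((peak / s * expR (v / 2))%:E * lint (tilt s M) (s ^+ 2 * v))%E.
Proof.
move=> s0 aM; have [M0 _] := aM.
have [t0 _] := tilt_antitone s0 aM.
rewrite /sqint.
have e0 : 0 <= peak / s * expR (v / 2).
  by rewrite !mulr_ge0 ?expR_ge0 ?invr_ge0 ?(ltW s0) ?(ltW peak_gt0).
rewrite [X in (_ * X)%E](@ge0_integral_affine _ s 0)//; last 2 first.
- exact: measurable_sqint weight_cst1 (tilt_antitone s0 aM).
- by move=> y; rewrite mul1e.
have ms : measurable_fun setT
    (fun t => tilt s M (s ^+ 2 * v + (s * t + 0) ^+ 2)%R).
  apply: measurableT_comp.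
    by apply: ge0_antitone_measurable; exact: tilt_antitone.
  apply: measurable_funD => //; apply: measurable_funX.
  by apply: measurable_funD => //; exact: mulrl_measurable.
rewrite muleA -EFinM -ge0_integralZl_EFin//; last 3 first.
- by move=> t _; rewrite mul1e.
- by under eq_fun do rewrite mul1e.
- by rewrite mulr_ge0 ?(ltW s0).
apply: eq_integral => t _; rewrite mul1e /tilt muleA -EFinM addr0.
have -> : s ^+ 2 * v + (s * t) ^+ 2 = s ^+ 2 * (v + t ^+ 2) by ring.
congr (_%:E * _)%E; rewrite normal_pdf01E /gw.
have -> : - t ^+ 2 / 2 = v / 2 + - (s ^+ 2 * (v + t ^+ 2)) / (s ^+ 2 *+ 2).
  by field; lra.
by rewrite expRD; field; lra.
Qed.

(** Each coordinate contributes one factor [peak / s] through [sqint_tilt], while the exponential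
    prefactors of successive coordinates cancel against the Gaussian factor, leaving only the
    outermost one. *)
Lemma iter_sqint_tilt k (s : R) M v : 0 < s -> ge0_antitone M ->
  iter k (sqint phi) (fun u => M (s ^+ 2 * u)) v =
  (((peak / s) ^+ k * expR (v / 2))%:E *
     iter k lint (tilt s M) (s ^+ 2 * v)%R)%E.
Proof.
move=> s0 aM; have at_ := tilt_antitone s0 aM.
have ps0 : 0 <= peak / s by rewrite divr_ge0 ?(ltW s0) ?(ltW peak_gt0).
set F := fun u => M (s ^+ 2 * u).
have aF : ge0_antitone F by apply: ge0_antitone_scale => //; exact: sqr_ge0.
elim: k v => [|k IH] v.
  rewrite /= /tilt /gw muleA -EFinM expr0 mul1r.
  have -> : - (s ^+ 2 * v) / (s ^+ 2 *+ 2) = - (v / 2) by field; lra.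
  by rewrite -expRD subrr expR0 mul1e.
set L := iter k lint (tilt s M) in IH *.
have aL : ge0_antitone L by apply: iter_sqint_antitone; [exact: weight_cst1|].
(* The inner iterate is written as a function of the rescaled squared norm, the form [sqint_tilt]
   expects. *)
pose M' u := iter k (sqint phi) F (s ^- 2 * u).
have aM' : ge0_antitone M'.
  apply: ge0_antitone_scale; first by rewrite invr_ge0 sqr_ge0.
  by apply: iter_sqint_antitone => //; exact: weight_normal.
have FE : iter k (sqint phi) F = fun u => M' (s ^+ 2 * u).
  by apply/funext => u; rewrite /M' mulKf// expf_neq0// gt_eqF.
(* The prefactor supplied by the induction hypothesis is the inverse of [gw s u]. *)
have tM' : tilt s M' = fun u => (((peak / s) ^+ k)%:E * L u)%E.
  apply/funext => u; rewrite /tilt /M' IH mulVKf ?expf_neq0 ?gt_eqF//.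
  rewrite muleA -EFinM; congr (_%:E * _)%E; rewrite mulrCA /gw -expRD.
  have -> : - u / (s ^+ 2 *+ 2) + s ^- 2 * u / 2 = 0 by field; lra.
  by rewrite expR0 mulr1.
rewrite iterS FE sqint_tilt// tM' (sqintZ _ weight_cst1 aL) ?exprn_ge0//.
by rewrite muleA -EFinM; congr (_%:E * _)%E; rewrite exprS; ring.
Qed.
End Gauss.

(** * Neyman-Pearson comparison of a centred ball with a half-space *)

Section NeymanPearson.
Variable R : realType.
Local Notation mu := (@lebesgue_measure R).
Local Notation phi := (@normal_pdf R 0 1).
Local Notation peak := (@normal_peak R 1).
Local Notation lint := (sqint (fun=> 1%R : R)).
Implicit Types (M : R -> \bar R).

(* Normalising constant of N(s^2 theta e_1, s^2 I) in dimension k.+1, once the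
   factor [expR (theta * y_1 - |y|^2 / (2 * s^2))] has been split off. *)
Definition shell_cst k (s theta : R) : R :=
  (peak / s) ^+ k.+1 * expR (- (s * theta) ^+ 2 / 2).

Lemma shell_cst_gt0 k (s theta : R) : 0 < s -> 0 < shell_cst k s theta.
Proof.
by move=> s0; rewrite mulr_gt0 ?expR_gt0// exprn_gt0// divr_gt0// peak_gt0.
Qed.

(** Substitute [y = s * t + s ^+ 2 * theta] in the first coordinate, apply [iter_sqint_tilt] to the
    others and complete the square. The factor [h] will describe a half-space and [M] a ball; the
    tilt [expR (theta * y)] does not depend on [s], so two variances can be compared under one
    integral. *)
Lemma shell_integral k (s theta : R) (h : R -> R) M : 0 < s ->
  measurable_fun setT h -> (forall y, 0 <= h y) -> ge0_antitone M ->
  (\int[mu]_t ((phi t)%:E * ((h (s * t + s ^+ 2 * theta)%R)%:E *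
      iter k (sqint phi) (fun u => M (s ^+ 2 * u)%R) ((t + s * theta) ^+ 2)%R)) =
   (shell_cst k s theta)%:E *
   \int[mu]_y ((expR (theta * y) * h y)%:E * iter k lint (tilt s M) (y ^+ 2)%R))%E.
Proof.
move=> s0 mh h0 aM; have aT := tilt_antitone s0 aM.
have aL := iter_sqint_antitone k (weight_cst1 R) aT.
have [L0 _] := aL.
set L := iter k lint _ in aL L0 *.
pose f y : \bar R := ((expR (theta * y) * h y)%:E * L (y ^+ 2)%R)%E.
have mf : measurable_fun setT f.
  apply: emeasurable_funM.
    apply/measurable_EFinP; apply: measurable_funM => //.
    by apply: measurableT_comp => //; exact: mulrl_measurable.
  apply: measurableT_comp; first exact: ge0_antitone_measurable.
  exact: exprn_measurable.
have f0 y : (0 <= f y)%E by rewrite mule_ge0// lee_fin mulr_ge0// expR_ge0.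
rewrite [X in (_ * X)%E](@ge0_integral_affine _ s (s ^+ 2 * theta) f)//.
have maff : measurable_fun setT (fun t : R => s * t + s ^+ 2 * theta).
  by apply: measurable_funD => //; exact: mulrl_measurable.
have cst0 := shell_cst_gt0 k theta s0.
rewrite muleA -EFinM -ge0_integralZl_EFin//; last 2 first.
- by apply: measurableT_comp.
- by rewrite mulr_ge0 ?(ltW s0) ?(ltW cst0).
apply: eq_integral => t _; rewrite /f iter_sqint_tilt// -/L.
have -> : s * t + s ^+ 2 * theta = s * (t + s * theta) by ring.
rewrite (exprMn _ s) !muleA -!EFinM; congr (_%:E * _)%E.
rewrite normal_pdf01E /shell_cst (exprS _ k).
have e : expR (- t ^+ 2 / 2) * expR ((t + s * theta) ^+ 2 / 2) =
    expR (- (s * theta) ^+ 2 / 2) * expR (theta * (s * (t + s * theta))).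
  by rewrite -!expRD; congr expR; field.
set y := s * (t + s * theta) in e *.
rewrite [LHS](_ : _ = peak * h y * (peak / s) ^+ k *
  (expR (- t ^+ 2 / 2) * expR ((t + s * theta) ^+ 2 / 2))); last by field; lra.
by rewrite e; field; lra.
Qed.

Lemma normal_prob_itvNyE (x : R) :
  normal_prob 0 1 `]-oo, x]%classic = (\int[mu]_t ((phi t)%:E * below x t))%E.
Proof.
rewrite /normal_prob integral_mkcond; apply: eq_integral => t _.
rewrite patchE /below; case: ifPn; rewrite ?inE ?notin_setE/= in_itv/=.
  by move=> ->; rewrite mule1.
by move=> /negP/negbTE ->; rewrite mule0.
Qed.

Lemma measurable_le_indicator (c : R) :
  measurable_fun setT (fun y : R => (y <= c)%R%:R : R).
Proof.
rewrite (_ : (fun y => _) = \1_(`]-oo, c]%classic : set R)) //.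
by apply/funext => y; rewrite indicE mem_setE in_itv.
Qed.

(** The half-space constrains the first coordinate only, so the other [k] Gaussian integrals equal 1
    and can be inserted freely, giving an integral of the same shape as for the ball. *)
Lemma Phi_shell k (s theta c : R) : 0 < s ->
  normal_prob 0 1 `]-oo, c / s - s * theta]%classic =
  ((shell_cst k s theta)%:E *
   \int[mu]_y ((expR (theta * y) * (y <= c)%R%:R)%:E *
     iter k lint (tilt s (fun=> 1%E)) (y ^+ 2)%R))%E.
Proof.
move=> s0; rewrite normal_prob_itvNyE -(@shell_integral k s theta
  (fun y => (y <= c)%R%:R) (fun=> 1%E))//.
- apply: eq_integral => t _; rewrite iter_normal1 mule1 /below.
  rewrite (_ : (t <= _) = (s * t + s ^+ 2 * theta <= c)).
    by case: ifP.
  rewrite lerBrDr ler_pdivlMr//; congr (_ <= _); ring.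
- rewrite (_ : (fun y => _) = \1_(`]-oo, c]%classic : set R))//.
  by apply/funext => y; rewrite indicE mem_setE in_itv.
Qed.

Lemma ball_shell k (s theta r : R) : 0 < s ->
  (\int[mu]_t ((phi t)%:E *
     iter k (sqint phi) (below (r / s ^+ 2)) ((t + s * theta) ^+ 2)%R) =
  (shell_cst k s theta)%:E *
   \int[mu]_y ((expR (theta * y))%:E *
     iter k lint (tilt s (below r)) (y ^+ 2)%R))%E.
Proof.
move=> s0; under [in RHS]eq_integral do rewrite -[expR _]mulr1.
rewrite -(@shell_integral k s theta (fun=> 1) (below r))//; last exact: below_antitone.
apply: eq_integral => t _; rewrite mul1e.
suff -> : below (r / s ^+ 2) = fun u => below r (s ^+ 2 * u) by [].
by apply/funext => u; rewrite /below ler_pdivlMr ?exprn_gt0// mulrC.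
Qed.


(** The noncentral chi-squared cdf in dimension [k.+1] with noncentrality [m ^+ 2], kept in the
    extended reals. *)
Definition ball_prob k (m x : R) : \bar R :=
  (\int[mu]_t ((phi t)%:E *
     iter k (sqint phi) (below x) ((t + m) ^+ 2)%R))%E.

(** The ratio of [x * gw s u] to [y * gw S u] is [expR ((r - u) * d)] with [d] nonnegative because
    [s < S]; it equals 1 at [u = r]. *)
Lemma gw_cross (s S x y r : R) : 0 < s -> s < S -> 0 < x -> 0 < y ->
  x * gw s r = y * gw S r ->
  (forall u, u <= r -> y * gw S u <= x * gw s u) /\
  (forall u, r <= u -> x * gw s u <= y * gw S u).
Proof.
move=> s0 sS x0 y0 xy; have S0 := lt_trans s0 sS.
pose d := (s ^+ 2 *+ 2)^-1 - (S ^+ 2 *+ 2)^-1.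
have d0 : 0 <= d.
  rewrite subr_ge0 lef_pV2 ?posrE ?pmulrn_lgt0 ?exprn_gt0// lerMn2r/=.
  by rewrite ler_sqr ?nnegrE ?ltW.
have E u : x * gw s u = y * gw S u * expR ((r - u) * d).
  have -> : gw s u = gw s r * expR ((r - u) / (s ^+ 2 *+ 2)).
    by rewrite /gw -expRD; congr expR; rewrite -mulrDl; congr (_ / _); ring.
  rewrite mulrA xy -!mulrA; congr (_ * _).
  by rewrite /gw -!expRD; congr expR; rewrite /d; ring.
split=> u ur; rewrite E.
- rewrite ler_peMr ?mulr_ge0 ?expR_ge0 ?(ltW y0)//.
  by rewrite -expR0 ler_expR mulr_ge0// subr_ge0.
- rewrite ler_piMr ?mulr_ge0 ?expR_ge0 ?(ltW y0)//.
  by rewrite -expR0 ler_expR mulr_le0_ge0// subr_le0.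
Qed.

(* Neyman-Pearson: the density ratio of N(s^2 theta e_1, s^2 I) and
   N(S^2 theta e_1, S^2 I) is a function of the squared norm only, decreasing
   as s < S, and kappa is its value on the sphere of squared radius r. *)
Lemma ball_vs_halfspace k (s S theta r c : R) : 0 < s -> s < S ->
  exists2 kappa : R, 0 < kappa &
    (normal_prob 0 1 `]-oo, (c / s - s * theta)%R]%classic +
       kappa%:E * ball_prob k (S * theta) (r / S ^+ 2) <=
     ball_prob k (s * theta) (r / s ^+ 2) +
       kappa%:E * normal_prob 0 1 `]-oo, (c / S - S * theta)%R]%classic)%E.
Proof.
move=> s0 sS; have S0 := lt_trans s0 sS.
have x0 := shell_cst_gt0 k theta s0; have z0 := shell_cst_gt0 k theta S0.
set x := shell_cst k s theta in x0; set z := shell_cst k S theta in z0.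
pose kap := x * gw s r / (z * gw S r).
have kap0 : 0 < kap by apply: divr_gt0; apply: mulr_gt0 => //; exact: expR_gt0.
exists kap => //.
have y0 : 0 < kap * z by rewrite mulr_gt0.
have [lo hi] : (forall u, u <= r -> kap * z * gw S u <= x * gw s u) /\
  (forall u, r <= u -> x * gw s u <= kap * z * gw S u).
  have zg : z * gw S r != 0 by rewrite gt_eqF// mulr_gt0// expR_gt0.
  apply: gw_cross => //; by rewrite -[RHS]mulrA divfK.
rewrite /ball_prob !ball_shell// !(Phi_shell k)// -/x -/z !muleA -!EFinM.
pose cst1 := fun _ : R => 1%E : \bar R.
have aA q : 0 < q -> ge0_antitone (tilt q (below r)).
  by move=> q0; apply: tilt_antitone => //; exact: below_antitone.
have aE q : 0 < q -> ge0_antitone (tilt q cst1).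
  by move=> q0; apply: tilt_antitone => //; exact: ge0_antitone_cst.
(* [A] and [E] integrate the Gaussian factor over the last [k] coordinates, with and without the
   ball constraint. *)
pose A q v := iter k lint (tilt q (below r)) v.
pose E q v := iter k lint (tilt q cst1) v.
have ww := weight_cst1 R.
have aIA q : 0 < q -> ge0_antitone (A q).
  by move=> q0; exact: iter_sqint_antitone (aA _ q0).
have aIE q : 0 < q -> ge0_antitone (E q).
  by move=> q0; exact: iter_sqint_antitone (aE _ q0).
have aZ (w : R) M : 0 <= w -> ge0_antitone M -> ge0_antitone (fun v => w%:E * M v)%E.
  by move=> w0; apply: ge0_antitoneM; exact: ge0_antitone_cst.
(* Beyond the hyperplane only the ball terms remain, and inside the ball [lo] compares the
   densities. *)
have off v : ((kap * z)%:E * A S v <= x%:E * A s v)%E.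
  rewrite -!(iter_sqintZ _ _ ww) ?(ltW y0) ?(ltW x0)//; [|exact: aA|exact: aA].
  apply: iter_sqint_le => // [||u]; [apply: aZ; [exact: ltW|exact: aA]..|].
  rewrite /tilt /below; case: ifPn => ur; last by rewrite !mule0.
  by rewrite !mule1 -!EFinM lee_fin lo.
(* Within the half-space the two sides agree inside the ball; outside it only the unconstrained
   terms remain, and [hi] applies. Additive form avoids subtracting extended reals. *)
have on v : (x%:E * E s v + (kap * z)%:E * A S v <=
             x%:E * A s v + (kap * z)%:E * E S v)%E.
  rewrite -!(iter_sqintZ _ _ ww) ?(ltW y0) ?(ltW x0)//; [|exact: aE|exact: aA..|exact: aE].
  rewrite -!(iter_sqintD _ _ ww); [|apply: aZ; [exact: ltW|by [exact: aA|exact: aE]]..].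
  apply: iter_sqint_le => //.
  - by apply: ge0_antitoneD; apply: aZ; rewrite ?ltW//; [exact: aE|exact: aA].
  - by apply: ge0_antitoneD; apply: aZ; rewrite ?ltW//; [exact: aA|exact: aE].
  move=> u; rewrite /tilt /below /cst1; case: ifPn => ur; rewrite ?mule0 ?mule1 ?adde0 ?add0e//.
  by rewrite -!EFinM lee_fin hi// ltW// ltNge.
pose f (g : R -> R) F (y : R) : \bar R := ((g y)%:E * F (y ^+ 2)%R)%E.
have mf g F : measurable_fun setT g -> ge0_antitone F -> measurable_fun setT (f g F).
  move=> mg aF; apply: emeasurable_funM; first exact/measurable_EFinP.
  apply: measurableT_comp; first exact: ge0_antitone_measurable.
  exact: exprn_measurable.
have f0 g F y : (forall t, 0 <= g t) -> ge0_antitone F -> (0 <= f g F y)%E.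
  by move=> g0 [F0 _]; rewrite mule_ge0// lee_fin.
pose e (y : R) := expR (theta * y).
pose eK (y : R) := expR (theta * y) * (y <= c)%R%:R.
have me : measurable_fun setT e.
  by apply: measurableT_comp => //; exact: mulrl_measurable.
have meK : measurable_fun setT eK.
  by apply: measurable_funM => //; exact: measurable_le_indicator.
have e0 t : 0 <= e t by exact: expR_ge0.
have eK0 t : 0 <= eK t by rewrite mulr_ge0 ?expR_ge0.
rewrite -/(f eK (E s)) -/(f e (A S)) -/(f e (A s)) -/(f eK (E S)).
have mZ (w : R) g F : measurable_fun setT g -> ge0_antitone F ->
    measurable_fun setT (fun y => w%:E * f g F y)%E.
  by move=> mg aF; apply: emeasurable_funM => //; exact: mf.
have Z0 (w : R) g F y : 0 <= w -> (forall t, 0 <= g t) -> ge0_antitone F ->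
    (0 <= w%:E * f g F y)%E.
  by move=> w0 g0 aF; apply: mule_ge0; rewrite ?lee_fin// f0.
rewrite -!ge0_integralZl_EFin ?(ltW x0) ?(ltW y0)//; try by
  [move=> t _; apply: f0; auto | apply: mf; auto].
rewrite -!ge0_integralD//; try by
  [move=> t _; apply: Z0; auto using ltW | apply: mZ; auto].
apply: ge0_le_integral => //.
- by move=> t _; apply: adde_ge0; apply: Z0; auto using ltW.
- by apply: emeasurable_funD; apply: mZ; auto.
- by apply: emeasurable_funD; apply: mZ; auto.
(* The side of the hyperplane on which [t] lies selects [on] or [off]. *)
move=> t _; rewrite /f /eK /e; case: (t <= c) => /=.
  rewrite mulr1 !(muleCA _ (expR (theta * t))%:E).
  have pos (w : R) F : 0 < w -> ge0_antitone F -> (0 <= w%:E * F (t ^+ 2)%R)%E.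
    by move=> w0 [F0 _]; rewrite mule_ge0// lee_fin ltW.
  have p1 := pos _ _ x0 (aIE _ s0); have p2 := pos _ _ y0 (aIA _ S0).
  have p3 := pos _ _ x0 (aIA _ s0); have p4 := pos _ _ y0 (aIE _ S0).
  rewrite -(ge0_muleDr _ p1 p2) -(ge0_muleDr _ p3 p4).
  by apply: lee_wpmul2l (on _); rewrite lee_fin expR_ge0.
rewrite mulr0 !mul0e !mule0 add0e adde0 !(muleCA _ (expR (theta * t))%:E).
by apply: lee_wpmul2l (off _); rewrite lee_fin expR_ge0.
Qed.

End NeymanPearson.

(** * Quantiles of continuous distribution functions *)

Section Quantile.
Variable R : realType.
Implicit Types (F : R -> R) (p : R).
Local Open Scope classical_set_scope.

(** Approach the infimum [q] by [q - 1/(n+1)], where [F] is below [p], and by [q + 1/(n+1)], where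
    [F] is at least [p]; continuity gives both inequalities at [q]. The points [lo] and [hi] make
    the set bounded below and nonempty, so that [inf] is a genuine infimum. *)
Lemma quantile_cont F p (lo hi : R) :
  {homo F : x y / x <= y} ->
  (forall (u : nat -> R) x, u @ \oo --> x -> F \o u @ \oo --> F x) ->
  F lo < p -> p <= F hi -> F (quantile F p) = p.
Proof.
move=> ndF cF Flo Fhi; set A := [set x | p <= F x].
have lbA : lbound A lo.
    move=> x px; rewrite leNgt; apply/negP => /ltW/ndF Fx.
  by have := le_lt_trans (le_trans px Fx) Flo; rewrite ltxx.
have hA : has_lbound A by exists lo.
have A0 : A !=set0 by exists hi.
rewrite /quantile -/A; set q := inf A.
have hn : (fun n => n.+1%:R^-1 : R) @ \oo --> (0 : R) by exact: cvg_harmonic.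
apply/eqP; rewrite eq_le; apply/andP; split.
- have c1 : (fun n => q - n.+1%:R^-1) @ \oo --> q.
    by rewrite -[X in _ --> X]subr0; apply: cvgB => //; exact: cvg_cst.
  apply: (cvgr_to_le (cF _ _ c1)); apply: nearW => n /=.
  rewrite leNgt; apply/negP => /ltW Aq.
  have : q <= q - n.+1%:R^-1 by exact: ge_inf.
  by apply/negP; rewrite -ltNge ltrBlDr ltrDl invr_gt0.
- have c1 : (fun n => q + n.+1%:R^-1) @ \oo --> q.
    by rewrite -[X in _ --> X]addr0; apply: cvgD => //; exact: cvg_cst.
  apply: (cvgr_to_ge (cF _ _ c1)); apply: nearW => n /=.
  have [|y /= Ay yq] := @inf_lt _ A (q + n.+1%:R^-1) A0.
    by rewrite ltrDl invr_gt0.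
  by rewrite (le_trans Ay)// ndF// ltW.
Qed.

End Quantile.

(** * Continuity and limits of the noncentral chi-squared cdf *)

Section ChiContinuity.
Variable R : realType.
Local Notation mu := (@lebesgue_measure R).
Local Notation phi := (@normal_pdf R 0 1).
Local Open Scope classical_set_scope.

Let mphi : measurable_fun setT (fun t : R => (phi t)%:E).
Proof. by apply/measurable_EFinP; exact: measurable_normal_pdf. Qed.

(** Since the functions take values in [0, 1], the normal density itself dominates. *)
Lemma normal_dct (h_ : nat -> R -> \bar R) (h : R -> \bar R) :
  (forall n, measurable_fun setT (h_ n)) -> measurable_fun setT h ->
  (forall n t, (0 <= h_ n t <= 1)%E) ->
  {ae mu, forall t, h_ ^~ t @ \oo --> h t} ->
  (fun n => \int[mu]_t ((phi t)%:E * h_ n t))%E @ \oo -->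
    (\int[mu]_t ((phi t)%:E * h t))%E.
Proof.
move=> mh_ mh h01 hh.
have phi0 t : (0 <= (phi t)%:E)%E by rewrite lee_fin normal_pdf_ge0.
have m1 n : measurable_fun setT (fun t => (phi t)%:E * h_ n t)%E.
  exact: emeasurable_funM.
have m2 : measurable_fun setT (fun t => (phi t)%:E * h t)%E.
  exact: emeasurable_funM.
have cv : {ae mu, forall t, setT t ->
    (fun n => (phi t)%:E * h_ n t)%E @ \oo --> ((phi t)%:E * h t)%E}.
  by apply: (@filterS _ _ (ae_filter_ringOfSetsType mu) _ _ _ hh) => t ht _; apply: cvgeZl.
have dom : {ae mu, forall t n, setT t ->
    (`|(phi t)%:E * h_ n t| <= (phi t)%:E)%E}.
  apply: aeW => t n _; have /andP[h0 h1] := h01 n t.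
  rewrite gee0_abs; last exact: mule_ge0.
  by rewrite -[leRHS]mule1; exact: lee_wpmul2l.
by have [] := @dominated_convergence _ _ _ mu setT measurableT _ _ _ m1 m2 cv
  (integrable_normal_pdf 0 1) dom.
Qed.

(** A line meets a sphere in at most two points, so the jump of the ball's indicator is invisible to
    the integral over [t]. *)
Lemma ae_sq_neq (v m x : R) : {ae mu, forall t, x <> v + (t + m) ^+ 2}.
Proof.
pose Z := [set Num.sqrt (x - v) - m; - Num.sqrt (x - v) - m].
have fZ : countable Z by apply: finite_set_countable; exact: finite_set2.
exists Z; split.
- by apply: countable_measurable.
- exact: countable_lebesgue_measure0.
move=> t /= /contrapT xE.
have : `|t + m| = Num.sqrt (x - v) by rewrite xE addrAC subrr add0r sqrtr_sqr.
by rewrite /Z/= => <-; case: (ger0P (t + m)) => _; [left|right]; lra.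
Qed.

Let G k x v := iter k (sqint phi) (below x) v.

Let G01 k (x v : R) : (0 <= G k x v <= 1)%E.
Proof.
apply/andP; split; last exact: iter_normal_le1.
have [G0 _] := iter_sqint_antitone k (weight_normal R) (below_antitone x).
exact: G0.
Qed.

Let mG k (x v m : R) : measurable_fun setT (fun t : R => G k x (v + (t + m) ^+ 2)%R).
Proof.
apply: measurableT_comp.
  apply: ge0_antitone_measurable.
  exact: iter_sqint_antitone (weight_normal R) (below_antitone x).
apply: measurable_funD => //; apply: measurable_funX.
exact: measurable_funD.
Qed.

Let GS k (x v : R) :
  G k.+1 x v = (\int[mu]_t ((phi t)%:E * G k x (v + (t + 0) ^+ 2)%R))%E.
Proof. by rewrite /G /= /sqint; apply: eq_integral => t _; rewrite addr0. Qed.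

Let cvg_below (u : nat -> R) (x v : R) : u @ \oo --> x -> x <> v ->
  (fun n => below (u n) v) @ \oo --> below x v.
Proof.
move=> ux /eqP xv; apply: cvg_near_cst; rewrite /below.
have [vx|xv'|/esym/eqP] := ltgtP v x; last by rewrite (negbTE xv).
- by apply: filterS (cvgr_ge _ ux _ vx) => n ->.
- by apply: filterS (cvgr_lt _ ux _ xv') => n; rewrite ltNge => /negbTE ->.
Qed.

(** Convergence off the sphere is enough under the integral, by [ae_sq_neq]; this drives both the
    induction on [k] and the continuity of [ball_prob]. *)
Let cvg_int k (u : nat -> R) (x v m : R) :
  (forall w, x <> w -> (fun n => G k (u n) w) @ \oo --> G k x w) ->
  (fun n => \int[mu]_t ((phi t)%:E * G k (u n) (v + (t + m) ^+ 2)%R))%E @ \oo -->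
  (\int[mu]_t ((phi t)%:E * G k x (v + (t + m) ^+ 2)%R))%E.
Proof.
move=> cG; apply: normal_dct => //.
by apply: (@filterS _ _ (ae_filter_ringOfSetsType mu) _ _ _ (ae_sq_neq v m x)) => t; exact: cG.
Qed.

Let cvg_G k (u : nat -> R) (x v : R) : u @ \oo --> x -> x <> v ->
  (fun n => G k (u n) v) @ \oo --> G k x v.
Proof.
move=> ux; elim: k v => [|k IH] v xv; first exact: cvg_below.
under eq_fun do rewrite GS; rewrite GS.
exact: cvg_int.
Qed.

Lemma ball_probE k (m x : R) : ball_prob k m x =
  (\int[mu]_t ((phi t)%:E * G k x (0 + (t + m) ^+ 2)%R))%E.
Proof. by apply: eq_integral => t _; rewrite add0r. Qed.

Lemma ball_prob_continuous k (m : R) (u : nat -> R) (x : R) : u @ \oo --> x ->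
  (fun n => ball_prob k m (u n)) @ \oo --> ball_prob k m x.
Proof.
move=> ux; under eq_fun do rewrite ball_probE; rewrite ball_probE.
by apply: cvg_int => w; exact: cvg_G.
Qed.

Let cvg_belowy (v : R) : (fun n => below n%:R v) @ \oo --> (1%E : \bar R).
Proof.
apply: cvg_near_cst; near=> n; rewrite /below ifT//; near: n; exact: nbhs_infty_ger.
Unshelve. all: by end_near. Qed.

Let integral_normal1 : (\int[mu]_t ((phi t)%:E * 1%E) = 1)%E.
Proof. by under eq_integral do rewrite mule1; rewrite integral_normal_pdf. Qed.

Let cvg_inty k (v m : R) : (forall w, (fun n => G k n%:R w) @ \oo --> 1%E) ->
  (fun n => \int[mu]_t ((phi t)%:E * G k n%:R (v + (t + m) ^+ 2)%R))%E @ \oo --> 1%E.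
Proof.
move=> cG; rewrite -integral_normal1.
by apply: normal_dct => //; apply: aeW => t.
Qed.

Let cvg_Gy k (v : R) : (fun n => G k n%:R v) @ \oo --> 1%E.
Proof.
elim: k v => [|k IH] v; first exact: cvg_belowy.
by under eq_fun do rewrite GS; exact: cvg_inty.
Qed.

Lemma cvg_ball_proby k (m : R) : (fun n => ball_prob k m n%:R) @ \oo --> 1%E.
Proof. by under eq_fun do rewrite ball_probE; exact: cvg_inty. Qed.

Lemma cvg_normal_proby :
  (fun n => normal_prob 0 1 `]-oo, (n%:R : R)]) @ \oo --> 1%E.
Proof.
under eq_fun do rewrite normal_prob_itvNyE.
rewrite -integral_normal1.
apply: normal_dct => //.
- by move=> n; exact: ge0_antitone_measurable (below_antitone _).
- by move=> n t; exact: (G01 0).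
- by apply: aeW => t.
Qed.

Lemma ball_prob_le k (m x y : R) : x <= y -> (ball_prob k m x <= ball_prob k m y)%E.
Proof.
move=> xy; rewrite !ball_probE; apply: ge0_le_integral => //.
- move=> t _; have /andP[g0 _] := G01 k x (0 + (t + m) ^+ 2).
  by rewrite mule_ge0// lee_fin normal_pdf_ge0.
- by apply: emeasurable_funM; [exact: mphi|exact: mG].
- by apply: emeasurable_funM; [exact: mphi|exact: mG].
move=> t _; apply: lee_wpmul2l; first by rewrite lee_fin normal_pdf_ge0.
apply: iter_sqint_le; [exact: weight_normal|exact: below_antitone..|].
move=> w; rewrite /below; case: ifPn => [wx|_]; first by rewrite (le_trans wx xy).
by case: ifP => _; rewrite lee_fin.
Qed.

Lemma ball_prob01 k (m x : R) : (0 <= ball_prob k m x <= 1)%E.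
Proof.
rewrite ball_probE; apply/andP; split.
  apply: integral_ge0 => t _; have /andP[g0 _] := G01 k x (0 + (t + m) ^+ 2).
  by rewrite mule_ge0// lee_fin normal_pdf_ge0.
rewrite -[leRHS](integral_normal_pdf 0 1); apply: ge0_le_integral => //.
- move=> t _; have /andP[g0 _] := G01 k x (0 + (t + m) ^+ 2).
  by rewrite mule_ge0// lee_fin normal_pdf_ge0.
- by apply: emeasurable_funM; [exact: mphi|exact: mG].
move=> t _; rewrite -[leRHS]mule1; apply: lee_wpmul2l.
  by rewrite lee_fin normal_pdf_ge0.
by have /andP[] := G01 k x (0 + (t + m) ^+ 2).
Qed.

Lemma ball_prob_fin_num k (m x : R) : ball_prob k m x \is a fin_num.
Proof.
have /andP[b0 b1] := ball_prob01 k m x.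
by rewrite ge0_fin_numE// (le_lt_trans b1)// ltry.
Qed.

Lemma ball_prob_lt0 k (m x : R) : x < 0 -> ball_prob k m x = 0%E.
Proof.
move=> x0; have G0 j v : 0 <= v -> G j x v = 0%E.
  elim: j v => [|j IH] v v0; first by rewrite /G /below /= ifF// leNgt (lt_le_trans x0).
  rewrite GS integral0_eq// => t _; rewrite IH ?mule0//.
  by rewrite addr_ge0// sqr_ge0.
by rewrite ball_probE integral0_eq// => t _; rewrite G0 ?mule0// add0r sqr_ge0.
Qed.

Lemma chi2_cdf_ball k (m x : R) : 0 <= m ->
  (chi2_cdf k.+1 (m ^+ 2) x)%:E = ball_prob k m x.
Proof. by move=> m0; rewrite chi2_cdfE// fineK//; exact: ball_prob_fin_num. Qed.

(** Continuity of the cdf in [x] makes the quantile a right inverse. *)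
Lemma chi2_cdf_qf k (m p : R) : 0 <= m -> 0 < p < 1 ->
  chi2_cdf k.+1 (m ^+ 2) (chi2_qf k.+1 (m ^+ 2) p) = p.
Proof.
move=> m0 /andP[p0 p1].
have E x : chi2_cdf k.+1 (m ^+ 2) x = fine (ball_prob k m x).
  by rewrite -chi2_cdf_ball.
have /cvgr_ge : (fun n => chi2_cdf k.+1 (m ^+ 2) n%:R) @ \oo --> (1 : R).
  under eq_fun do rewrite E.
  exact: fine_cvg (cvg_ball_proby k m).
move=> /(_ _ p1) [n _ /(_ n (leqnn n)) /= hi].
(* The cdf is 0 at -1 and at least [p] at a large integer [n], its limit being 1. *)
apply: (@quantile_cont _ _ _ (-1) n%:R) => //.
- move=> x y xy; rewrite !E fine_le ?ball_prob_fin_num//; exact: ball_prob_le.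
- move=> u x ux; rewrite /comp; under eq_fun do rewrite E; rewrite E.
  by apply: fine_cvg; rewrite fineK ?ball_prob_fin_num//; exact: ball_prob_continuous.
- by rewrite E ball_prob_lt0// ltrN10.
Qed.

End ChiContinuity.

(** * The standard normal cdf: monotonicity, symmetry and quantile *)

Section PhiFacts.
Variable R : realType.
Local Notation mu := (@lebesgue_measure R).
Local Notation phi := (@normal_pdf R 0 1).
Local Notation N x := (normal_prob 0 1 `]-oo, x%R]%classic).
Implicit Types x y : R.

Lemma PhiE x : (Phi x)%:E = N x.
Proof. by rewrite /Phi fineK//; exact: fin_num_measure. Qed.

Lemma Phi_lt x y : x < y -> Phi x < Phi y.
Proof.
move=> xy; rewrite -lte_fin !PhiE.
have xy' : (BRight x <= BRight y)%O by rewrite bnd_simp ltW.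
rewrite (@itv_bndbnd_setU _ _ -oo%O (BRight x) (BRight y))//=.
rewrite measureU//=; last first.
  apply/seteqP; split=> // t []; rewrite /= !in_itv/= => tx /andP[xt _].
  by move: (lt_le_trans xt tx); rewrite ltxx.
rewrite lteDl ?fin_num_measure//.
(* A lower bound for the density on []x, y]]: whatever the sign of [t], its square is at most
   [x ^+ 2 + y ^+ 2]. *)
pose c0 := normal_peak 1 * expR (- (x ^+ 2 + y ^+ 2) / 2) : R.
have c00 : 0 < c0 by rewrite mulr_gt0 ?expR_gt0 ?peak_gt0.
apply: (@lt_le_trans _ _ (\int[mu]_(t in `]x, y]%classic) c0%:E)%E).
  rewrite integral_cst//= lebesgue_measure_itv/= lte_fin xy -EFinD -EFinM lte_fin.
  by rewrite mulr_gt0// subr_gt0.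
apply: ge0_le_integral => //.
- by move=> t _; rewrite lee_fin ltW.
- by apply: measurable_funTS; apply/measurable_EFinP; exact: measurable_normal_pdf.
move=> t; rewrite /= in_itv/= => /andP[xt ty].
rewrite lee_fin normal_pdf01E ler_pM2l ?peak_gt0// ler_expR ler_pM2r// lerN2.
have [t0|t0] := leP 0 t; nra.
Qed.

Lemma PhiN x : Phi (- x) = 1 - Phi x.
Proof.
apply: EFin_inj; rewrite EFinB !PhiE.
rewrite -probability_setC// setCitvl.
rewrite normal_prob_itvNyE ge0_integral_opp//; last 2 first.
- apply: emeasurable_funM; last exact: ge0_antitone_measurable (below_antitone _).
  by apply/measurable_EFinP; exact: measurable_normal_pdf.
- move=> t; rewrite mule_ge0 ?lee_fin ?normal_pdf_ge0//.
  by rewrite /below; case: ifP.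
rewrite -[RHS]/(\int[mu]_(t in `]x, +oo[%classic) (phi t)%:E)%E.
(* The complement is an open ray and the reflected ray is closed; the endpoint is null. *)
rewrite integral_itv_obnd_cbnd; last first. 
  by apply: measurable_funTS; apply/measurable_EFinP; exact: measurable_normal_pdf.
rewrite [RHS]integral_mkcond; apply: eq_integral => t _.
rewrite patchE /below normal_pdfN lerN2.
rewrite (_ : (t \in _) = (x <= t)); last by rewrite mem_setE in_itv/= andbT.
by case: ifP => _; rewrite ?mule1 ?mule0.
Qed.

Lemma Phi0 : Phi (0 : R) = 1 / 2.
Proof. by have := PhiN 0; rewrite oppr0; lra. Qed.

(** Below [x] the infimum yields some [y] with [p <= Phi y], and [Phi] is strictly increasing. As
    [Phi] tends to 1, the set is nonempty. *)
Lemma Phi_inv_lt p x : p < 1 -> Phi_inv p < x -> p < Phi x.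
Proof.
move=> p1 qx.
have /cvgr_ge : ((fun n => Phi n%:R) @ \oo --> (1 : R))%classic.
  exact: fine_cvg (@cvg_normal_proby R).
move=> /(_ _ p1) [n _ /(_ n (leqnn n)) /= hi].
have [|y /= py yx] := inf_lt _ qx; first by exists n%:R.
exact: le_lt_trans py (Phi_lt yx).
Qed.

Lemma chi2_cdf_vs_Phi k (s S theta r c : R) : 0 < s -> s < S -> 0 <= theta ->
  exists2 kappa : R, 0 < kappa &
    Phi (c / s - s * theta) +
      kappa * chi2_cdf k.+1 ((S * theta) ^+ 2) (r / S ^+ 2) <=
    chi2_cdf k.+1 ((s * theta) ^+ 2) (r / s ^+ 2) +
      kappa * Phi (c / S - S * theta).
Proof.
move=> s0 sS t0; have S0 := lt_trans s0 sS.
have [kap kap0 NP] := ball_vs_halfspace k theta r c s0 sS.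
exists kap => //; rewrite -lee_fin !EFinD !EFinM !PhiE.
by rewrite !chi2_cdf_ball// mulr_ge0// ltW.
Qed.

End PhiFacts.

(** * The certified radius bound, for smaller and for larger variance *)

Theorem mainTheorem8 (R : realType) (N : nat) (sigma0 pA a : R) :
  (1 <= N)%N -> 0 < sigma0 -> 0 < pA < 1 -> 0 <= a ->
  (forall sigma1 : R, 0 < sigma1 -> sigma1 < sigma0 ->
     xi_gt N sigma0 pA a sigma1 <= 1 / 2 -> a <= sigma0 * Phi_inv pA) /\
  (forall sigma1 : R, sigma0 < sigma1 ->
     xi_lt N sigma0 pA a sigma1 <= 1 / 2 -> a <= sigma0 * Phi_inv pA).
Proof.
case: N => // k _ s0 /andP[p0 p1] a0.
(* Both noncentralities become [(s * theta) ^+ 2] with [theta = a / d]. *)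
have lamE (s d : R) : s ^+ 2 * a ^+ 2 / d ^+ 2 = (s * (a / d)) ^+ 2.
  by rewrite !exprMn exprVn mulrA.
have contra : (pA < Phi (a / sigma0) -> False) -> a <= sigma0 * Phi_inv pA.
  move=> h; rewrite leNgt; apply/negP => q; apply: h.
  by apply: Phi_inv_lt => //; rewrite ltr_pdivlMr// mulrC.
split=> sigma1 h1; [move=> h2|]; rewrite /xi_gt /xi_lt !lamE => xi; apply: contra => pa.
- have d0 : 0 < sigma0 ^+ 2 - sigma1 ^+ 2 by rewrite subr_gt0 ltr_sqr ?nnegrE ?ltW.
  set theta := a / _ in xi.
  have t0 : 0 <= theta by rewrite divr_ge0// ltW.
  have st0 : 0 <= sigma0 * theta by rewrite mulr_ge0// ltW.
  have p01 : 0 < 1 - pA < 1 by apply/andP; split; lra.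
  have := chi2_cdf_qf k st0 p01; set q := chi2_qf _ _ _ in xi * => Fq.
  (* The ball has squared radius [sigma0 ^+ 2 * q], hence probability [1 - pA] under Y_0; the
     hyperplane passes through the mean [sigma1 ^+ 2 * theta] of Y_1. *)
  have [kap kap0] := chi2_cdf_vs_Phi k (sigma0 ^+ 2 * q) (sigma1 ^+ 2 * theta) h1 h2 t0.
  rewrite (_ : _ / sigma0 ^+ 2 = q); last by field; rewrite gt_eqF.
  rewrite (mulrAC _ q) Fq.
  rewrite (_ : _ / sigma1 - _ = 0); last by field; rewrite gt_eqF.
  rewrite (_ : _ / sigma0 - _ = - (a / sigma0)); last first.
    by rewrite /theta; field; rewrite !gt_eqF.
  (* The half-space has probability 1/2 under Y_1 and less than [1 - pA] under Y_0; as [kap] is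
     positive, [xi] would exceed 1/2. *)
  rewrite Phi0 PhiN; nra.
- have sg1 := lt_trans s0 h1.
  have d0 : 0 < sigma1 ^+ 2 - sigma0 ^+ 2 by rewrite subr_gt0 ltr_sqr ?nnegrE ?ltW.
  set theta := a / _ in xi.
  have t0 : 0 <= theta by rewrite divr_ge0// ltW.
  have st0 : 0 <= sigma0 * theta by rewrite mulr_ge0// ltW.
  have p01 : 0 < pA < 1 by rewrite p0.
  have := chi2_cdf_qf k st0 p01; set q := chi2_qf _ _ _ in xi * => Fq.
  (* The roles of the variances are exchanged: the ball now has probability [pA] under Y_0, and its
     complement is the optimal region. *)
  have [kap kap0] := chi2_cdf_vs_Phi k (sigma0 ^+ 2 * q) (sigma1 ^+ 2 * theta) s0 h1 t0.
  rewrite (_ : _ / sigma0 ^+ 2 = q); last by field; rewrite gt_eqF.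
  rewrite (mulrAC _ q) Fq.
  rewrite (_ : _ / sigma1 - _ = 0); last by field; rewrite gt_eqF.
  rewrite (_ : _ / sigma0 - _ = a / sigma0); last first.
    by rewrite /theta; field; rewrite !gt_eqF.
  (* The half-space has probability above [pA] under Y_0, which forces the ball's probability under
     Y_1 below 1/2, against [xi]. *)
  rewrite Phi0; nra.
Qed.
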